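(* Let $\Gamma$ be a canonical signed unicyclic graph whose unique cycle $C_g^\sigma$ has length $g$. (1) If $\Gamma$ is a cycle (i.e. $\Gamma=C_g^\sigma$), then $i_-(\Gamma)=\lceil g/2\rceil$ if and only if either $C_g^\sigma$ is balanced and $g\equiv 2,3\pmod 4$, or $C_g^\sigma$ is unbalanced and $g\equiv 0,1\pmod 4$. Suppose now $\Gamma$ is not a cycle. Let $v_1,\dots,v_k$ ($k\ge1$) be the major vertices, listed in cyclic order along $C_g^\sigma$, and let $l_1,\dots,l_k\ge 0$ be the numbers of vertices of $C_g^\sigma$ strictly between consecutive major vertices $v_j$ and $v_{j+1}$ (indices mod $k$; for $k=1$, $l_1=g-1$), so that $C_g^\sigma-\{v_1,\dots,v_k\}$ is a disjoint union of paths of orders $l_1,\dots,l_k$ (a path of order $0$ being empty) and $g=k+l_1+\cdots+l_k$. (2) If $g\equiv 1,3\pmod 4$, then $i_-(\Gamma)=\lceil g/2\rceil$ if and only if exactly one of $l_1,\dots,l_k$ is even. (3) If $g\equiv 0,2\pmod 4$, then $i_-(\Gamma)=\lceil g/2\rceil$ if and only if all of $l_1,\dots,l_k$ are odd.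
   Context: A signed graph $\Gamma=(G,\sigma)$ is a simple graph $G$ with a sign function $\sigma:E(G)\to\{+,-\}$; its adjacency matrix has $(u,v)$-entry $\sigma(uv)$ if $uv\in E(G)$, $0$ otherwise, and $i_-(\Gamma)$ is its number of negative eigenvalues. A cycle is balanced if the product of its edge signs is $+$, unbalanced otherwise. A signed unicyclic graph is a connected signed graph with exactly one cycle. It is called canonical if, with $C$ its unique cycle, every vertex not on $C$ is adjacent to exactly one vertex of $C$ and the vertices not on $C$ are pairwise nonadjacent (equivalently, every vertex is at distance at most $1$ from $C$, the vertices at distance $1$ form an independent set, and each has exactly one neighbour on $C$). A vertex of $C$ having at least one neighbour outside $C$ is called a major vertex; the major vertex together with its neighbours outside $C$ forms a pendant star. *)

(* Defs.v *)
From HB Require Import structures.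
From mathcomp Require Import all_boot all_order all_algebra.
From mathcomp Require Import polyorder polyrcf.
Set Implicit Arguments. Unset Strict Implicit. Unset Printing Implicit Defensive.
Import Order.TTheory GRing.Theory Num.Theory.
Local Open Scope ring_scope.

(* A signed graph on a finite vertex type V: a simple graph given by a
   symmetric irreflexive relation [adj], and a sign [sg u v] (true = negative
   sign, false = positive sign) on edges, required symmetric on edges. *)
Definition simple_graph (V : finType) (adj : rel V) : Prop :=
  (forall u v, adj u v = adj v u) /\ (forall v, ~~ adj v v).

Definition sign_on_edges (V : finType) (adj : rel V) (sg : V -> V -> bool) : Prop :=
  forall u v, adj u v -> sg u v = sg v u.

Definition signed_adj_mx (R : nzRingType) (V : finType) (adj : rel V)
  (sg : V -> V -> bool) : 'M[R]_#|V| :=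
  \matrix_(i, j) (if adj (enum_val i) (enum_val j)
                  then (if sg (enum_val i) (enum_val j) then -1 else 1)
                  else 0).

(* Number of negative eigenvalues (with multiplicity) of a square matrix over a
   real closed field: sum of the multiplicities of the negative (real) roots of
   the characteristic polynomial.  For the real symmetric adjacency matrices
   considered here all eigenvalues are real. *)
Definition neg_inertia (R : rcfType) (n : nat) (A : 'M[R]_n) : nat :=
  (\sum_(x <- rootsR (char_poly A) | (x < 0)%R) \mu_x (char_poly A))%N.

Definition i_minus (R : rcfType) (V : finType) (adj : rel V) (sg : V -> V -> bool) : nat :=
  neg_inertia (signed_adj_mx R adj sg).

Definition connected_graph (V : finType) (adj : rel V) : Prop :=
  forall u v, connect adj u v.

Definition is_cycle_seq (V : finType) (adj : rel V) (c : seq V) : bool :=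
  [&& uniq c, 3 <= size c & cycle adj c]%N.

Definition unicyclic_with_cycle (V : finType) (adj : rel V) (c : seq V) : Prop :=
  [/\ connected_graph adj, is_cycle_seq adj c &
      forall c', is_cycle_seq adj c' ->
        exists i, c' = rot i c \/ c' = rot i (rev c)].

Definition canonical_wrt (V : finType) (adj : rel V) (c : seq V) : Prop :=
  (forall v, v \notin c -> count (adj v) c = 1%N) /\
  (forall u v, u \notin c -> v \notin c -> ~~ adj u v).

(* Balanced cycle: product of signs is +, i.e. even number of negative edges. *)
Definition cycle_edges (V : Type) (c : seq V) : seq (V * V) := zip c (rot 1 c).

Definition balanced (V : finType) (sg : V -> V -> bool) (c : seq V) : bool :=
  ~~ odd (count (fun e => sg e.1 e.2) (cycle_edges c)).

Definition is_major (V : finType) (adj : rel V) (c : seq V) (v : V) : bool :=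
  (v \in c) && [exists u, (u \notin c) && adj v u].

Fixpoint runs (s : bitseq) (acc : nat) : seq nat :=
  match s with
  | [::] => [:: acc]
  | true :: s' => acc :: runs s' 0
  | false :: s' => runs s' acc.+1
  end.

(* The numbers l_1, ..., l_k of vertices of C strictly between consecutive
   major vertices (cyclically); rotate c to start at a major vertex. *)
Definition gap_lengths (V : finType) (adj : rel V) (c : seq V) : seq nat :=
  let b := map (is_major adj c) c in
  runs (behead (rot (index true b) b)) 0.

(* Main.v *)
Require Import Defs.
From HB Require Import structures.
From mathcomp Require Import all_boot all_order all_algebra.
From mathcomp Require Import perm complex polyorder polyrcf.
From mathcomp Require Import zify ring.
Set Implicit Arguments.
Unset Strict Implicit.
Unset Printing Implicit Defensive.
Import Order.TTheory GRing.Theory Num.Theory.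
Local Open Scope ring_scope.
Local Open Scope sesquilinear_scope.

(* By Sylvester's law of inertia, the number of negative eigenvalues of a real
   symmetric matrix can be computed by pivoting on hyperbolic planes: removing
   a pendant vertex together with its neighbour lowers it by exactly one.  If
   Gamma is not a cycle, removing the k stars leaves isolated vertices and
   paths of orders l_j, whence i_- = k + sum_j floor(l_j / 2), that is,
   2 i_- = g + #{j | l_j even}.  For a cycle, pivoting on an edge yields a cycle
   with two vertices fewer and the opposite balance, and induction goes down
   to the degenerate "cycles" on one and two vertices. *)

(** * Sylvester's law of inertia *)

Lemma diag_form (C : numClosedFieldType) n (d w : 'rV[C]_n) :
  (w *m diag_mx d *m w^t*) 0 0 = \sum_i `|w 0 i| ^+ 2 * d 0 i.
Proof.
rewrite !mxE; apply: eq_bigr => i _.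
by rewrite mul_mx_diag !mxE normCK mulrAC.
Qed.

(* Otherwise there is a nonzero combination of the rows of P with e_i < 0 that
   vanishes on the coordinates with d_j < 0; the form is both negative and
   nonnegative there. *)
Lemma sylvester_le (C : numClosedFieldType) n (P : 'M[C]_n) (d e : 'rV[C]_n) :
    d \is a realmx -> P *m diag_mx d *m P^t* = diag_mx e ->
  (#|[pred i | (e 0 i < 0)%R]| <= #|[pred i | (d 0 i < 0)%R]|)%N.
Proof.
move=> dreal PdP.
set I := [pred i | e 0 i < 0]; set J := [pred i | d 0 i < 0].
rewrite leqNgt; apply/negP => ltJI.
pose f (i : 'I_#|I|) : 'I_n := enum_val i.
pose M : 'M[C]_(#|I|, #|J|) := mxsub f enum_val P.
have : kermx M != 0.
  by rewrite -mxrank_eq0 mxrank_ker subn_eq0 -ltnNge (leq_ltn_trans (rank_leq_col M)).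
case/rowV0Pn => x /sub_kermxP xM0 x0.
pose w := x *m rowsub f P.
have wJ j : d 0 j < 0 -> w 0 j = 0.
  move=> dj; have jJ : j \in J by [].
  have /matrixP/(_ 0 (enum_rank_in jJ j)) := xM0.
  rewrite !mxE => h; rewrite -[RHS]h; apply: eq_bigr => k _.
  by rewrite !mxE enum_rankK_in.
(* Since [P] carries [d] to [e], the form of [d] at [w] is the form of [e] at [x], restricted to the
   indices in [I]. *)
have : (w *m diag_mx d *m w^t*) 0 0 = (x *m diag_mx (\row_i e 0 (f i)) *m x^t*) 0 0.
  have -> : diag_mx (\row_i e 0 (f i)) = rowsub f P *m diag_mx d *m (rowsub f P)^t*.
    have -> : (rowsub f P)^t* = colsub f (P^t*) by apply/matrixP => i j; rewrite !mxE.
    rewrite -mulmxA mulmx_colsub -mxsub_mul mulmxA PdP.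
    by apply/matrixP => i j; rewrite !mxE (inj_eq enum_val_inj).
  by rewrite /w trmx_mul map_mxM !mulmxA.
rewrite !diag_form => eqs.
have : 0 <= \sum_i `|w 0 i| ^+ 2 * d 0 i.
  apply: sumr_ge0 => i _; have [/wJ ->|di] := boolP (d 0 i < 0).
    by rewrite normr0 expr0n mul0r.
  rewrite mulr_ge0 ?exprn_ge0 // real_leNgt ?real0 //.
  exact: (mxOverP dreal).
have [k xk] : exists k, x 0 k != 0 by apply/rV0Pn.
rewrite eqs; apply/negP; rewrite -real_ltNge ?real0 //; last first.
  apply: sum_real => i _; rewrite mxE ler0_real // mulr_ge0_le0 ?exprn_ge0 //.
  by apply: ltW; have := enum_valP i.
rewrite (bigD1 k) //= mxE.
rewrite ltr_wnDr //; last first.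
  by rewrite nmulr_llt0 ?exprn_gt0 ?normr_gt0 //; have := enum_valP k.
apply: sumr_le0 => i _; rewrite mxE mulr_ge0_le0 ?exprn_ge0 //.
by apply: ltW; have := enum_valP i.
Qed.

Lemma char_poly_conj (F : fieldType) n (P A : 'M[F]_n) :
  P \in unitmx -> char_poly (invmx P *m A *m P) = char_poly A.
Proof.
move=> Pu; rewrite /char_poly.
have -> : char_poly_mx (invmx P *m A *m P) =
    map_mx polyC (invmx P) *m char_poly_mx A *m map_mx polyC P.
  rewrite /char_poly_mx !map_mxM /= mulmxBr mulmxBl.
  by rewrite scalar_mxC -[_%:M *m _ *m _]mulmxA -(map_mxM _ (invmx P) P) mulVmx // map_mx1 mulmx1.
rewrite !det_mulmx mulrAC -det_mulmx -(map_mxM _ (invmx P) P) mulVmx // map_mx1 det1.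
by rewrite mul1r.
Qed.

(** The multiplicity of a root of a split polynomial is its number of occurrences in [s], and
    [rootsR] lists the same elements as [undup s]. *)
Lemma neg_inertia_split (R : rcfType) n (A : 'M[R]_n) (s : seq R) :
  char_poly A = \prod_(x <- s) ('X - x%:P) ->
  neg_inertia A = count (fun x => x < 0) s.
Proof.
move=> Es; rewrite /neg_inertia Es.
have mus x : (\mu_x (\prod_(y <- s) ('X - y%:P)) = count_mem x s)%N.
  elim: (s) => [|y t IH]; first by rewrite big_nil mu_polyC.
  rewrite big_cons mu_mul; last first.
    rewrite mulf_neq0 ?polyXsubC_eq0 // monic_neq0 //.
    by apply: monic_prod => i _; rewrite monicXsubC.
  rewrite IH /=; congr (_ + _)%N; have [->|nxy] := eqVneq y x.
    by rewrite mu_XsubC.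
  by rewrite muNroot // root_XsubC eq_sym.
have p0 : \prod_(x <- s) ('X - x%:P) != 0 :> {poly R}.
  by rewrite monic_neq0 //; apply: monic_prod => i _; rewrite monicXsubC.
rewrite (perm_big (undup s)) /=; last first.
  apply: uniq_perm; rewrite ?undup_uniq ?uniq_roots // => x.
  by rewrite mem_undup -(roots_on_rootsR p0) inE root_prod_XsubC.
rewrite -sum1_count -[RHS]big_undup_iterop_count.
by apply: eq_bigr => x _; rewrite mus Monoid.iteropE iter_addn_0 mul1n.
Qed.

Lemma neg_inertia_char_prod (R : rcfType) n (A : 'M[R]_n) (d : 'rV[R]_n) :
  char_poly A = \prod_i ('X - (d 0 i)%:P) ->
  neg_inertia A = #|[pred i | d 0 i < 0]|.
Proof.
move=> Ed; rewrite (@neg_inertia_split _ _ _ [seq d 0 i | i <- enum 'I_n]).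
  by rewrite -sum1_count -sum1_card big_map big_enum_cond.
by rewrite Ed big_map big_enum.
Qed.

Lemma congr_mxK (F : fieldType) n (P A : 'M[F]_n) :
  P \in unitmx -> invmx P *m (P *m A *m P^T) *m (invmx P)^T = A.
Proof.
move=> Pu; rewrite !mulmxA mulVmx // mul1mx -mulmxA -trmx_mul mulVmx //.
by rewrite trmx1 mulmx1.
Qed.

(** If [U] and [W] diagonalise [A] and [P *m A *m P^t*], then [W *m P *m invmx U] carries the first
    diagonal form to the second, as [sylvester_le] requires. *)
Lemma congr_mxC_comp (C : numClosedFieldType) n (U W P A : 'M[C]_n) :
    U \in unitmx ->
  (W *m P *m invmx U) *m (U *m A *m U^t*) *m (W *m P *m invmx U)^t* =
    W *m (P *m A *m P^t*) *m W^t*.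
Proof.
move=> Uu; rewrite !trmx_mul !map_mxM !mulmxA mulmxKV //.
have UK : U^t* *m (invmx U)^t* = 1%:M.
  by rewrite -map_mxM -trmx_mul mulVmx // trmx1 map_mx1.
by rewrite -[_ *m U^t* *m _]mulmxA UK mulmx1.
Qed.

(** * Congruence invariance over a real closed field *)

Section RealSymmetric.

Variable R : rcfType.
Let toC : {rmorphism R -> R[i]} := real_complex R.
Local Notation "M ^C" := (map_mx toC M).

Let realC m n (M : 'M[R]_(m, n)) : M^C \is a realmx.
Proof. by apply/mxOverP => i j; rewrite mxE complex_real. Qed.

(** The spectral theorem is applied over [R[i]]. Hermitian eigenvalues are real, so the diagonal
    descends to [R]; the characteristic polynomials are compared through the injection into
    [R[i]]. *)
Lemma symmetric_diag n (A : 'M[R]_n) : A^T = A ->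
  exists d : 'rV[R]_n, exists2 U : 'M[R[i]]_n, U \in unitmx &
    U *m A^C *m U^t* = diag_mx d^C /\ char_poly A = \prod_i ('X - (d 0 i)%:P).
Proof.
move=> symA.
have hA : A^C \is hermsymmx.
  apply: realsym_hermsym => //; apply/is_hermitianmxP.
  by rewrite expr0 scale1r map_mx_id // map_trmx symA.
have /orthomx_spectralP EA := hermitian_normalmx hA.
have dr := hermitian_spectral_diag_real hA.
set U := spectralmx _ in EA; set D := spectral_diag _ in EA dr.
have Uu : U \in unitmx := spectral_unit _.
exists (map_mx (@complex.Re R) D), U => //.
have ED : (map_mx (@complex.Re R) D)^C = D.
  by apply/matrixP => i j; rewrite !mxE; apply: RRe_real; apply: (mxOverP dr).
split.
  rewrite ED EA -(invmx_unitary (spectral_unitarymx _)) -/U.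
  by rewrite !mulmxA mulmxV // mul1mx mulmxK.
apply: (map_poly_inj toC); rewrite map_char_poly EA char_poly_conj //.
rewrite rmorph_prod char_poly_trig ?diag_mx_is_trig //.
apply: eq_bigr => i _.
by rewrite rmorphB /= map_polyX map_polyC /= -[in LHS]ED !mxE eqxx mulr1n.
Qed.

Lemma neg_inertia_congr_le n (P A : 'M[R]_n) : A^T = A ->
  P \in unitmx -> (neg_inertia (P *m A *m P^T) <= neg_inertia A)%N.
Proof.
move=> symA Pu.
have symB : (P *m A *m P^T)^T = P *m A *m P^T.
  by rewrite !trmx_mul trmxK symA mulmxA.
have [d [U Uu [EU cA]]] := symmetric_diag symA.
have [e [W Wu [EW cB]]] := symmetric_diag symB.
rewrite (neg_inertia_char_prod cA) (neg_inertia_char_prod cB).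
have := @sylvester_le _ n (W *m P^C *m invmx U) d^C e^C (realC _).
have neg_eq (v : 'rV[R]_n) : #|[pred i | v^C 0 i < 0]| = #|[pred i | v 0 i < 0]|.
  by apply: eq_card => i; rewrite !inE mxE ltcR.
rewrite !neg_eq; apply.
have trC : (P^T)^C = P^C^t*.
  by apply/matrixP => i j; rewrite !mxE; apply/esym/CrealP; rewrite complex_real.
rewrite -EU -EW congr_mxC_comp; last exact: Uu.
rewrite 2!map_mxM trC; reflexivity.
Qed.

(** The reverse inequality is [neg_inertia_congr_le] for the inverse congruence. *)
Lemma neg_inertia_congr n (P A : 'M[R]_n) : A^T = A ->
  P \in unitmx -> neg_inertia (P *m A *m P^T) = neg_inertia A.
Proof.
move=> symA Pu; apply/eqP; rewrite eqn_leq neg_inertia_congr_le //=.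
have symB : (P *m A *m P^T)^T = P *m A *m P^T.
  by rewrite !trmx_mul trmxK symA mulmxA.
have := @neg_inertia_congr_le _ (invmx P) _ symB.
rewrite unitmx_inv => /(_ Pu).
by rewrite congr_mxK.
Qed.

Lemma neg_inertia_block n m (A : 'M[R]_n) (B : 'M[R]_m) :
  A^T = A -> B^T = B ->
  neg_inertia (block_mx A 0 0 B) = (neg_inertia A + neg_inertia B)%N.
Proof.
move=> /symmetric_diag[d [_ _ [_ cA]]] /symmetric_diag[e [_ _ [_ cB]]].
rewrite (neg_inertia_split (s := [seq d 0 i | i <- enum 'I_n] ++ [seq e 0 i | i <- enum 'I_m])).
  rewrite count_cat; congr (_ + _)%N; apply/esym; apply: neg_inertia_split.
    by rewrite cA big_map big_enum.
  by rewrite cB big_map big_enum.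
rewrite /char_poly char_block_diag_mx det_ublock big_cat /= !big_map.
rewrite -[LHS]/(char_poly A * char_poly B) cA cB.
by congr (_ * _); rewrite big_enum.
Qed.

End RealSymmetric.

(** * Elimination of vertices *)

Section Pivots.

Variable R : rcfType.

(* Block elimination with the row multiplier [C] given, so that [B] need not be
   invertible. *)
Lemma neg_inertia_schur m n (B : 'M[R]_m) (D : 'M[R]_n) (C : 'M[R]_(n, m)) :
  B^T = B -> D^T = D ->
  neg_inertia (block_mx B (C *m B)^T (C *m B) D) =
    (neg_inertia B + neg_inertia (D - C *m B *m C^T))%N.
Proof.
move=> symB symD.
have tS : (D - C *m B *m C^T)^T = D - C *m B *m C^T.
  by rewrite linearB /= !trmx_mul trmxK symB symD mulmxA.
rewrite -neg_inertia_block //.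
rewrite -(@neg_inertia_congr _ _ (block_mx 1%:M 0 (- C) 1%:M) (block_mx B _ _ D)).
- congr neg_inertia; rewrite tr_block_mx !trmx1 trmx0 !mulmx_block.
  rewrite !mul1mx !mulmx1 !mul0mx !mulmx0 !addr0 mulNmx trmx_mul symB linearN /=.
  by rewrite addNr mul0mx !add0r mulmxN addNr mulNmx mulmxA addrC.
- by rewrite tr_block_mx symB symD trmxK.
- by rewrite unitmxE det_lblock !det1 mulr1 unitr1.
Qed.

Lemma neg_inertia0 (A : 'M[R]_0) : neg_inertia A = 0%N.
Proof.
rewrite (neg_inertia_split (s := [::])) //.
by rewrite big_nil /char_poly det_mx00.
Qed.

Lemma neg_inertia1 (A : 'M[R]_1) : neg_inertia A = (A 0 0 < 0)%R.
Proof.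
rewrite (neg_inertia_split (s := [:: A 0 0])) /= ?addn0 //.
by rewrite big_seq1 /char_poly det_mx11 !mxE.
Qed.

(** With a = [A 0 1], the characteristic polynomial is X^2 - a^2, whose roots a and -a have opposite
    signs. *)
Lemma neg_inertia_hyperbolic (A : 'M[R]_2) : A 0 0 = 0 -> A 1 1 = 0 ->
  A 1 0 = A 0 1 -> A 0 1 != 0 -> neg_inertia A = 1%N.
Proof.
move=> A00 A11 A10 a0; rewrite (neg_inertia_split (s := [:: A 0 1; - A 0 1])) /=.
  by rewrite oppr_lt0 addn0; case: ltrgtP a0.
rewrite /char_poly (expand_det_row _ 0) !big_ord_recl big_ord0 /cofactor !det_mx11 !mxE /=.
have -> : lift 0 0 = 1 :> 'I_2 by apply/val_inj.
have -> : lift 1 0 = 0 :> 'I_2 by apply/val_inj.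
rewrite !big_cons big_nil A00 A11 A10.
by rewrite !polyCN !polyC0 /=; ring.
Qed.

Variable T : Type.
Implicit Types (A : T -> T -> R) (s t : seq T).

(** Indexing by a list turns the deletion of vertices into a list operation. *)
Definition seq_mx A s : 'M[R]_(size s) :=
  \matrix_(i, j) A (tnth (in_tuple s) i) (tnth (in_tuple s) j).

Definition neg_index A s := neg_inertia (seq_mx A s).

Lemma neg_index_tuple A n (t : n.-tuple T) :
  neg_index A t = neg_inertia (\matrix_(i, j) A (tnth t i) (tnth t j)).
Proof.
case: t => s i; have e : size s = n by apply/eqP.
subst n; congr neg_inertia; apply/matrixP => j k; rewrite !mxE.
by have x0 := tnth (in_tuple s) j; rewrite !(tnth_nth x0).
Qed.

Lemma neg_index_nil A : neg_index A [::] = 0%N.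
Proof. exact: neg_inertia0. Qed.

Lemma neg_index1 A x : neg_index A [:: x] = (A x x < 0)%R.
Proof. by rewrite /neg_index neg_inertia1 !mxE. Qed.

(** The block on [u] and [v] is hyperbolic and counts for one. Its inverse swaps the two coordinates
    and divides by [A u v], which gives the correction term of the Schur complement. *)
Lemma neg_index_pivot A u v s :
    (forall x y, A x y = A y x) -> A u u = 0 -> A v v = 0 -> A u v != 0 ->
  neg_index A [:: u, v & s] =
    (neg_index (fun x y => A x y - (A x u * A v y + A x v * A u y) / A u v) s).+1.
Proof.
move=> symA uu vv uv; set A' := fun x y => _.
pose B : 'M[R]_2 := \matrix_(i, j) A (nth u [:: u; v] i) (nth u [:: u; v] j).
(* The columns of [u] and [v] restricted to [s], multiplied by the inverse of [B]; thus [C *m B] is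
   this restriction. *)
pose C : 'M[R]_(size s, 2) :=
  \matrix_(i, j) (A (tnth (in_tuple s) i) (nth u [:: v; u] j) / A u v).
have symB : B^T = B by apply/matrixP => i j; rewrite !mxE symA.
have symD : (seq_mx A s)^T = seq_mx A s by apply/matrixP => i j; rewrite !mxE symA.
have CB : C *m B = \matrix_(i, j) A (tnth (in_tuple s) i) (nth u [:: u; v] j).
  apply/matrixP => i j; rewrite !mxE !big_ord_recl big_ord0 !mxE /=.
  have [->|->] : j = 0 \/ j = 1 by case: j => [[|[|]]] //= ?; [left|right]; apply/val_inj.
    by rewrite /= uu (symA v u) mulr0 add0r addr0 divfK.
  by rewrite /= vv mulr0 !addr0 divfK.
(* The size of [[:: u, v & s]] reduces to [2 + size s], so the block decomposition typechecks by
   conversion. *)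
have EM : (seq_mx A [:: u, v & s] : 'M_(2 + size s)) =
    block_mx B (C *m B)^T (C *m B) (seq_mx A s).
  rewrite CB; apply/matrixP => i j.
  rewrite -(splitK i) -(splitK j) [in LHS]mxE !(tnth_nth u).
  have nl (k : 'I_2) : nth u [:: u, v & s] (lshift (size s) k) = nth u [:: u; v] k.
    by rewrite (nth_cat u [:: u; v] s) /= ltn_ord.
  case: (split i) (split j) => i1 [] j1; rewrite /=.
  - by rewrite block_mxEul !mxE !nl.
  - by rewrite block_mxEur !mxE nl (tnth_nth u) /= symA.
  - by rewrite block_mxEdl !mxE nl (tnth_nth u).
  - by rewrite block_mxEdr !mxE !(tnth_nth u).
rewrite [LHS](congr1 (@neg_inertia R (2 + size s)) EM).
rewrite neg_inertia_schur // (neg_inertia_hyperbolic (A := B)) ?mxE //= add1n.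
congr (neg_inertia _).+1; rewrite CB; apply/matrixP => i j.
rewrite !mxE !big_ord_recl big_ord0 !mxE /= addr0 /A' mulrDl.
by rewrite -!mulrA (symA v) (symA u (tnth _ j)).
Qed.

End Pivots.

(** * Deleting isolated vertices and leaves *)

Section Pruning.

Variables (R : rcfType) (T : eqType).
Implicit Types (A B : T -> T -> R) (s t : seq T).

Lemma eq_in_neg_index A B s :
  {in s &, A =2 B} -> neg_index A s = neg_index B s.
Proof.
by move=> e; congr neg_inertia; apply/matrixP => i j; rewrite !mxE e ?mem_tnth.
Qed.

Lemma neg_index_map (T' : Type) (A : T' -> T' -> R) (f : T -> T') s :
  neg_index A (map f s) = neg_index (fun x y => A (f x) (f y)) s.
Proof.
rewrite -[map f s]/(tval (map_tuple f (in_tuple s))) neg_index_tuple.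
by congr neg_inertia; apply/matrixP => i j; rewrite !mxE !tnth_map.
Qed.

(** Reordering the list is a congruence by a permutation matrix. *)
Lemma neg_index_perm A s t : (forall x y, A x y = A y x) ->
  perm_eq s t -> neg_index A s = neg_index A t.
Proof.
move=> symA /[dup] /perm_size e; rewrite -[t]/(tval (in_tuple t)).
case/tuple_permP => p ->; rewrite !neg_index_tuple.
rewrite -[RHS](@neg_inertia_congr _ _ (perm_mx p)) ?unitmx_perm //; last first.
  by apply/matrixP => i j; rewrite !mxE symA.
congr neg_inertia; rewrite tr_perm_mx -row_permE -col_permE.
by apply/matrixP => i j; rewrite !mxE !tnth_mktuple.
Qed.

Lemma neg_index_isolated A u s : (forall x y, A x y = A y x) ->
  {in u :: s, forall x, A u x = 0} -> neg_index A (u :: s) = neg_index A s.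
Proof.
move=> symA u0; have symD : (seq_mx A s)^T = seq_mx A s.
  by apply/matrixP => i j; rewrite !mxE symA.
have EM : (seq_mx A (u :: s) : 'M_(1 + size s)) = block_mx 0 0 0 (seq_mx A s).
  apply/matrixP => i j; rewrite -(splitK i) -(splitK j) [in LHS]mxE !(tnth_nth u).
  case: (split i) (split j) => i1 [] j1; rewrite /= ?ord1.
  - by rewrite block_mxEul !mxE u0 ?mem_head.
  - by rewrite block_mxEur !mxE u0 /= ?in_cons ?mem_nth ?orbT ?add0n.
  - by rewrite block_mxEdl !mxE symA u0 /= ?in_cons ?mem_nth ?orbT ?add0n.
  - by rewrite block_mxEdr !mxE !(tnth_nth u).
rewrite [LHS](congr1 (@neg_inertia R (1 + size s)) EM).
by rewrite neg_inertia_block ?trmx0 // neg_inertia1 mxE ltxx.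
Qed.

Lemma neg_index0 A s : {in s &, forall x y, A x y = 0} -> neg_index A s = 0%N.
Proof.
move=> A0; have -> : neg_index A s = neg_index (fun _ _ => 0 : R) s.
  exact: eq_in_neg_index.
elim: s {A0} => [|u s IH]; first exact: neg_index_nil.
by rewrite neg_index_isolated.
Qed.

(** Each correction term of the pivot contains an entry of [A] between [u] and [s], and these
    vanish. *)
Lemma neg_index_leaf A u v s : (forall x y, A x y = A y x) ->
    {in u :: s, forall x, A u x = 0} -> A v v = 0 -> A u v != 0 ->
  neg_index A [:: u, v & s] = (neg_index A s).+1.
Proof.
move=> symA u0 vv uv; rewrite neg_index_pivot //; last by rewrite u0 ?mem_head.
congr _.+1; apply: eq_in_neg_index => x y xs ys.
have [ux uy] : A u x = 0 /\ A u y = 0 by rewrite !u0 ?in_cons ?xs ?ys ?orbT.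
by rewrite (symA x u) ux uy mul0r mulr0 addr0 mul0r subr0.
Qed.

End Pruning.

(** * Paths and cycles *)

(* Size of the greedy matching of a path with pendant vertices; a bit is [true]
   when its vertex carries a pendant vertex. *)
Fixpoint path_index (b : bitseq) : nat :=
  match b with
  | [::] | [:: false] => 0
  | true :: b' => (path_index b').+1
  | false :: _ :: b' => (path_index b').+1
  end.

Lemma count_even_runsSS b k :
  count (fun l => ~~ odd l) (runs b k.+2) = count (fun l => ~~ odd l) (runs b k).
Proof.
by elim: b k => [|[] b IH] k /=; rewrite ?negbK ?IH.
Qed.

(** A marked vertex contributes 1 and an unmarked run of length l contributes floor(l/2), where 2
    floor(l/2) + 1 is l, plus 1 if l is even. The runs outnumber the marks by one, whence the
    successor on the left. *)
Lemma path_index_runs b :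
  (path_index b).*2.+1 = (size b + count (fun l => ~~ odd l) (runs b 0))%N.
Proof.
have [n] := ubnP (size b); elim: n b => // n IH [|[] [|[] b]] //= /ltnSE le.
- by have := IH (true :: b) le; rewrite /= => h; lia.
- by have := IH (false :: b) le; rewrite /= => h; lia.
- by have := IH b (ltnW le); lia.
- by have := IH b (ltnW le); rewrite count_even_runsSS; lia.
Qed.

(** The path [s] is pruned from its head. Vertices of [t] are only required to have at most one
    neighbour on [s], so that they may remain in [t], isolated, after their neighbour is removed. *)
Lemma neg_index_path (R : rcfType) (T : eqType) (A : T -> T -> R) (x0 : T) (s t : seq T) :
    (forall x y, A x y = A y x) -> (forall x, A x x = 0) -> uniq (s ++ t) ->
    (forall i j, (i < j < size s)%N -> (A (nth x0 s i) (nth x0 s j) != 0) = (j == i.+1)) ->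
    {in t &, forall u v, A u v = 0} ->
    {in t, forall u, {in s &, forall x y, A u x != 0 -> A u y != 0 -> x = y}} ->
  neg_index A (s ++ t) =
    path_index [seq has (fun u => A x u != 0) t | x <- s].
Proof.
move=> symA irrA.
have [n] := ubnP (size s); elim: n s t => // n IH [|x s] t /= /ltnSE le_s.
  by move=> _ _ t0 _; rewrite neg_index0.
case/andP => xNst ust pst t0 leaf.
(* If [x] carries a pendant vertex [u], both are removed; [u] has no other neighbour on the path, so
   the remaining bits are unchanged. *)
have [/hasP[u ut xu]|/hasPn xt0] := boolP (has _ t).
  have us : u \notin s by move: ust; rewrite cat_uniq => /and3P[_ /hasPn/(_ u ut)].
  have ux : u != x by apply: contraNneq xNst => <-; rewrite mem_cat ut orbT.
  have us0 y : y \in s -> A u y = 0.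
    move=> ys; apply/eqP; apply: contraNT xNst => uy; rewrite mem_cat.
    by rewrite (leaf u ut x y) ?mem_head ?ys // ?in_cons ?ys ?orbT // symA.
  rewrite (@neg_index_perm _ _ _ _ ([:: u, x & s ++ rem u t])) //; last first.
    by apply/seq.permP => p /=; rewrite !count_cat (seq.permP (perm_to_rem ut)) /=; lia.
  rewrite neg_index_leaf ?(symA u x) //; last first.
    move=> y; rewrite inE mem_cat => /or3P[/eqP->|/us0|/mem_rem]//.
    by move=> yt; apply: t0.
  rewrite IH //.
  - congr (path_index _).+1; apply/eq_in_map => y ys.
    rewrite (perm_has _ (perm_to_rem ut)) /= symA us0 // eqxx //.
  - rewrite (subseq_uniq _ ust) // cat_subseq // rem_subseq //.
  - by move=> i j ij; rewrite (pst i.+1 j.+1).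
  - by move=> v w /mem_rem vt /mem_rem wt; apply: t0.
  - by move=> v /mem_rem vt y z ys zs; apply: leaf => //; rewrite inE ?ys ?zs orbT.
(* Without a pendant vertex, [x] is isolated if the path ends there, and otherwise a leaf that is
   removed together with its neighbour [y]. *)
case: s => [|y s] in le_s xNst ust pst leaf *.
  by rewrite neg_index_isolated ?neg_index0 // => y; rewrite inE => /predU1P[->//|/xt0/negPn/eqP].
rewrite neg_index_leaf //.
- rewrite IH //=.
  + exact: ltnW.
  + by case/andP: ust.
  + by move=> i j ij; rewrite (pst i.+2 j.+2).
  + by move=> v vt a b aS bS; apply: leaf => //; rewrite !inE ?aS ?bS !orbT.
- move=> z; rewrite inE mem_cat => /or3P[/eqP->//|/(nthP x0)[i ik <-]|/xt0/negPn/eqP//].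
  by apply/eqP; rewrite -[_ == _]negbK (pst 0 i.+2).
- by rewrite (pst 0 1).
Qed.

(* The cycle on [0, ..., m] with weight [w i] on the edge from [i] to [i.+1] and
   [t] on the closing edge.  The overlapping terms give a loop of weight [2 t]
   when m = 0 and an edge of weight [w 0 + t] when m = 1, the base cases of the
   elimination. *)
Definition cycle_weight (R : rcfType) (w : nat -> R) (t : R) (m i j : nat) : R :=
  w i *+ (j == i.+1) + w j *+ (i == j.+1) +
  t *+ ((i == 0) && (j == m)) + t *+ ((j == 0) && (i == m)).

(** Signs are kept as exponents of -1, so that balance is the parity of their sum. The induction
    removes two vertices at a time. *)
Lemma neg_index_cycle (R : rcfType) (b : nat -> nat) (c m : nat) :
  neg_index (cycle_weight (fun i => (-1) ^+ b i) ((-1) ^+ c : R) m) (iota 0 m.+1) = m.+2./2 <->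
  odd (c + \sum_(i < m) b i) = (m.+1 %% 4 < 2)%N.
Proof.
have symW w (t : R) k i j : cycle_weight w t k i j = cycle_weight w t k j i.
  by rewrite /cycle_weight; ring.
have [n] := ubnP m; elim: n c m => // n IH c [|[|m]] /ltnSE le_m.
(* One vertex: the loop is negative exactly when [c] is odd. *)
- rewrite neg_index1 /cycle_weight big_ord0 addn0 /= !mulr0n !mulr1n !add0r -mulr2n.
  rewrite pmulrn_llt0 // -signr_odd; case: (odd c); rewrite ?expr1 ?expr0 ?ltrN10 ?ltr10 //=.
(* Two vertices: the two parallel weights add up to a pivot if their signs agree, and cancel
   otherwise. *)
- rewrite big_ord_recl big_ord0 addn0 oddD; set W := cycle_weight _ _ _.
  have sW x y : W x y = W y x by apply: symW.
  have W00 : W 0 0 = 0 by rewrite /W /cycle_weight /= !mulr0n !addr0.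
  have W11 : W 1%N 1%N = 0 by rewrite /W /cycle_weight /= !mulr0n !addr0.
  have W01 : W 0 1%N = (-1) ^+ odd (b 0) + (-1) ^+ odd c.
    by rewrite /W /cycle_weight /= !signr_odd !mulr0n !mulr1n !addr0.
  have [odd_eq|odd_neq] := eqVneq (odd c) (odd (b 0)).
    have W01_neq0 : W 0 1%N != 0 by rewrite W01 odd_eq -mulr2n mulrn_eq0 signr_eq0.
    by rewrite neg_index_pivot ?neg_index_nil // odd_eq addbb.
  have W01_0 : W 0 1%N = 0.
    by rewrite W01; case: (odd c) (odd (b 0)) odd_neq => [] [] //= _; rewrite ?addrN ?addNr.
  rewrite neg_index0; last first.
    by move=> x y; rewrite !inE => /orP[]/eqP-> /orP[]/eqP-> //; rewrite sW.
  by split=> //; case: (odd c) (odd (b 0)) odd_neq => [] [].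
set w := fun i => (-1) ^+ b i; set W := cycle_weight _ _ _.
have sW x y : W x y = W y x by apply: symW.
have Wu x : (x <= m.+1)%N -> W x m.+2 = (-1) ^+ c *+ (x == 0) + w m.+1 *+ (x == m.+1).
  move=> xm; rewrite /W /cycle_weight eqxx andbT eqSS andFb eq_sym.
  have -> : (x == m.+3) = false by lia.
  have [->|_] := eqVneq x m.+1; rewrite ?mulr0n ?addr0 //; ring.
have Wv x : (x <= m)%N -> W x m.+1 = w m *+ (x == m).
  move=> xm; rewrite /W /cycle_weight eqSS eq_sym.
  have -> : (x == m.+2) = false by lia.
  have -> : (m.+1 == m.+2) = false by lia.
  have [->|_] := eqVneq x m; rewrite ?andbF ?mulr0n ?addr0 //.
have WE : W m.+2 m.+1 = w m.+1 by rewrite sW Wu // eqxx mulr0n add0r.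
have w2 i : w i * w i = 1 by rewrite -expr2 sqrr_sign.
have w0 i : w i != 0 by rewrite signr_eq0.
have wV i : (w i)^-1 = w i by apply: (mulfI (w0 i)); rewrite divff ?w2.
rewrite (@neg_index_perm _ _ _ _ [:: m.+2, m.+1 & iota 0 m.+1]) //; last first.
  apply/seq.permP => p; rewrite -(addn2 m.+1) iotaD count_cat /= add0n; lia.
have Wuu : W m.+2 m.+2 = 0.
  rewrite /W /cycle_weight /=; have -> : (m.+2 == m.+3) = false by lia.
  by rewrite !mulr0n !addr0.
have Wvv : W m.+1 m.+1 = 0.
  rewrite /W /cycle_weight /=; have -> : (m.+1 == m.+2) = false by lia.
  by rewrite !mulr0n !addr0.
rewrite neg_index_pivot //; last by rewrite WE.
(* The correction only affects the pair [0], [m]. The path from [m] through [m.+1] and [m.+2] to [0]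
   is replaced by a closing edge whose weight is minus the product of the three removed ones, as
   [w m.+1] is its own inverse. *)
have -> : neg_index (fun x y => W x y - (W x m.+2 * W m.+1 y + W x m.+1 * W m.+2 y) / W m.+2 m.+1)
    (iota 0 m.+1) = neg_index (cycle_weight w ((-1) ^+ (c + b m + b m.+1).+1) m) (iota 0 m.+1).
  apply: eq_in_neg_index => x y; rewrite !mem_iota /= !add0n => xm ym.
  rewrite WE (sW m.+1) (sW m.+2) !Wu ?Wv //; try lia.
  have -> : (x == m.+1) = false by lia.
  have -> : (y == m.+1) = false by lia.
  rewrite wV /W /cycle_weight.
  have -> : (x == m.+2) = false by lia.
  have -> : (y == m.+2) = false by lia.
  rewrite exprS !exprD -/(w m) -/(w m.+1) !andbF !mulr0n !addr0.
  move: (w x *+ _) (w y *+ _) (w m) (w m.+1) ((-1) ^+ c) => a1 a2 a3 a4 a5.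
  case: (x == 0) (y == m) (x == m) (y == 0) => [] [] [] [];
  rewrite /= ?mulr0n ?mulr1n; ring.
have := IH (c + b m + b m.+1).+1 m (ltnW le_m).
set N := neg_index _ _; rewrite !big_ord_recr /=.
(* The new minus sign flips the parity, and the loss of two vertices flips the residue condition, so
   the equivalence carries over. *)
have -> : odd (c + (\sum_(i < m) b i + b m + b m.+1)) =
    ~~ odd ((c + b m + b m.+1).+1 + \sum_(i < m) b i).
  by rewrite !addSn /= negbK; congr odd; lia.
have -> : (m.+3 %% 4 < 2)%N = ~~ (m.+1 %% 4 < 2)%N by lia.
move=> IHm; split => [[NE]|/(congr1 negb)].
  by congr (~~ _); apply/IHm.
by rewrite !negbK => /IHm ->.
Qed.

(** * Signed unicyclic graphs *)

Section CycleOfGraph.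

Variables (V : finType) (adj : rel V) (x0 : V).
Hypothesis adj_sym : forall u v, adj u v = adj v u.

Lemma cycle_nthE c : (0 < size c)%N ->
  cycle adj c = sorted adj c && adj (nth x0 c (size c).-1) (nth x0 c 0).
Proof. by case: c => // x p _; rewrite nth_last /= rcons_path. Qed.

(** A chord would cut off a strictly shorter cycle, so equality of all cycle lengths suffices. *)
Lemma cycle_chordless c :
    is_cycle_seq adj c -> (forall c', is_cycle_seq adj c' -> size c' = size c) ->
  forall i j, (i < j < size c)%N ->
    adj (nth x0 c i) (nth x0 c j) = (j == i.+1) || (i == 0) && (j == (size c).-1).
Proof.
case/and3P => uc sc cc same_size i j /andP[ij jc].
have := cc; rewrite cycle_nthE ?(leq_trans _ sc) // => /andP[sorted_c c_last].
apply/idP/idP => [cij|/orP[/eqP je|/andP[/eqP -> /eqP ->]]]; last by rewrite adj_sym.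
  apply: contraTT (isT) => /norP[j_neq ij_neq].
  (* The segment from [i] to [j], closed by the chord, has at least 3 vertices because [j] is not
     [i.+1], and fewer than [size c] because [i] and [j] are not the two ends of [c]. *)
  have ss : size (take (j - i).+1 (drop i c)) = (j - i).+1.
    by rewrite size_takel // size_drop; lia.
  suff /same_size : is_cycle_seq adj (take (j - i).+1 (drop i c)) by rewrite ss; lia.
  rewrite /is_cycle_seq take_uniq ?drop_uniq //= cycle_nthE ?ss //.
  rewrite take_sorted ?drop_sorted //= !nth_take ?nth_drop // ?addn0 subnKC ?(ltnW ij) //.
  by rewrite adj_sym cij andbT; lia.
by rewrite je; apply: (sortedP x0 sorted_c); rewrite -je.
Qed.

End CycleOfGraph.

Lemma count1_inj (T : eqType) (a : pred T) (s : seq T) : count a s = 1%N ->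
  {in s &, forall x y, a x -> a y -> x = y}.
Proof.
rewrite -size_filter => sz x y xs ys ax ay.
have: x \in filter a s by rewrite mem_filter ax.
have: y \in filter a s by rewrite mem_filter ay.
by case: (filter a s) sz => [|z []] //= _; rewrite !inE => /eqP-> /eqP->.
Qed.

(** The closing edge is set apart from the others, to match [cycle_weight]. *)
Lemma count_cycle_edges (V : Type) (x0 : V) (a : V * V -> bool) (c : seq V) (m : nat) :
  size c = m.+1 ->
  count a (cycle_edges c) =
    (a (nth x0 c m, nth x0 c 0) + \sum_(i < m) a (nth x0 c i, nth x0 c i.+1))%N.
Proof.
case: c => // x p [sp]; rewrite /cycle_edges rot1_cons.
rewrite -sum1_count (big_nth (x0, x0)) size_zip size_rcons /= sp minnn.
rewrite big_mkcond big_nat_recr //= addnC; congr (_ + _)%N.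
  by rewrite nth_zip ?size_rcons //= nth_rcons sp ltnn eqxx; case: ifP.
rewrite big_mkord; apply: eq_bigr => i _.
by rewrite nth_zip ?size_rcons //= nth_rcons sp ltn_ord; case: ifP.
Qed.

Section SignedGraph.

Variables (R : rcfType) (V : finType) (adj : rel V) (sg : V -> V -> bool).

Definition signed_weight (u v : V) : R :=
  if adj u v then (if sg u v then -1 else 1) else 0.

Lemma i_minus_neg_index : i_minus R adj sg = neg_index signed_weight (enum V).
Proof.
have e : size (enum V) == #|V| by rewrite -cardE.
rewrite -[enum V]/(tval (Tuple e)) neg_index_tuple.
congr neg_inertia; apply/matrixP => i j; rewrite !mxE.
by rewrite !(tnth_nth (enum_val i)) -!enum_val_nth.
Qed.

Hypothesis adjG : simple_graph adj.
Hypothesis sgG : sign_on_edges adj sg.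

Let adj_sym u v : adj u v = adj v u. Proof. by case: adjG. Qed.

Lemma signed_weight_sym u v : signed_weight u v = signed_weight v u.
Proof. by rewrite /signed_weight adj_sym; case: ifP => // /sgG ->. Qed.

Lemma signed_weight_diag v : signed_weight v v = 0.
Proof. by rewrite /signed_weight ifN //; case: adjG. Qed.

Lemma signed_weight_neq0 u v : (signed_weight u v != 0) = adj u v.
Proof.
rewrite /signed_weight; case: ifP => _; rewrite ?eqxx //.
by case: ifP; rewrite ?oppr_eq0 oner_eq0.
Qed.

Lemma signed_weight_adj u v : adj u v -> signed_weight u v = (-1) ^+ sg u v.
Proof. by rewrite /signed_weight => ->; case: (sg u v). Qed.

Lemma signed_weight_nadj u v : ~~ adj u v -> signed_weight u v = 0.
Proof. by rewrite /signed_weight => /negPf ->. Qed.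

Variable c : seq V.
Hypothesis cycle_c : is_cycle_seq adj c.
Hypothesis same_size : forall c', is_cycle_seq adj c' -> size c' = size c.

(** As [c] has no chord, numbering the vertices along [c] turns the signed weights into a
    [cycle_weight]. *)
Lemma i_minus_cycle : (forall v, v \in c) ->
  i_minus R adj sg = (size c).+1./2 <-> balanced sg c = ~~ (size c %% 4 < 2)%N.
Proof.
move=> Vc; have /and3P[uc sc _] := cycle_c.
have x0 : V by case: c sc.
have [m sm] : exists m, size c = m.+1 by exists (size c).-1; rewrite prednK // (leq_trans _ sc).
rewrite i_minus_neg_index (@neg_index_perm _ _ _ _ c); first last.
- by apply: uniq_perm; rewrite ?enum_uniq // => v; rewrite mem_enum Vc.
- exact: signed_weight_sym.
have -> : neg_index signed_weight c = neg_index (cycle_weight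
    (fun i => (-1) ^+ sg (nth x0 c i) (nth x0 c i.+1))
    ((-1) ^+ sg (nth x0 c m) (nth x0 c 0) : R) m) (iota 0 m.+1).
  rewrite -{1}(mkseq_nth x0 c) /mkseq neg_index_map sm.
  apply: eq_in_neg_index => i j; rewrite !mem_iota /= !add0n.
  have chord := cycle_chordless x0 adj_sym cycle_c same_size.
  wlog ij : i j / (i <= j)%N => [th|].
    case: (leqP i j) => [/th//|/ltnW ji] im jm; rewrite signed_weight_sym th //.
    by rewrite /cycle_weight; ring.
  move=> im jm; have [->|nij] := eqVneq i j.
    rewrite signed_weight_diag /cycle_weight.
    have -> : (j == j.+1) = false by lia.
    have -> : (j == 0) && (j == m) = false by lia.
    by rewrite !mulr0n !addr0.
  have {ij nij}ij : (i < j)%N by lia.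
  have := chord i j; rewrite sm ij jm => /(_ isT) adj_ij; rewrite /cycle_weight.
  have -> : (i == j.+1) = false by lia.
  have -> : (j == 0) && (i == m) = false by lia.
  rewrite !mulr0n !addr0; have [ji|nji] := eqVneq j i.+1.
    have -> : (i == 0) && (j == m) = false by lia.
    rewrite mulr1n mulr0n addr0; move: adj_ij; rewrite ji eqxx => adj_ij.
    by rewrite signed_weight_adj ?adj_ij.
  rewrite mulr0n add0r; case: (boolP (_ && _)) adj_ij => [/andP[/eqP-> /eqP->]|cor] adj_ij.
    by rewrite mulr1n signed_weight_sym signed_weight_adj // adj_sym adj_ij orbT.
  by rewrite mulr0n signed_weight_nadj // adj_ij negb_or nji.
rewrite sm neg_index_cycle /balanced (count_cycle_edges x0 _ sm) /=.
case: (odd _) (_ < 2)%N => [] []; by split.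
Qed.

Hypothesis canon : canonical_wrt adj c.

(** Removing one major vertex [x] with one pendant neighbour [u] opens the cycle into a path [p]
    with pendant vertices, to which [neg_index_path] applies. *)
Lemma i_minus_noncycle : (exists v, v \notin c) ->
  (i_minus R adj sg).*2 = (size c + count (fun l => ~~ odd l) (gap_lengths adj c))%N.
Proof.
move=> [v vNc]; have /and3P[uc sc cc] := cycle_c.
have [pend indep] := canon.
have x0 := v.
(* The cycle is rotated to its first major vertex, as in [gap_lengths]; one exists because [v] has a
   neighbour on [c]. *)
set b := map (is_major adj c) c; set k := index true b.
have kb : (k < size b)%N.
  rewrite index_mem; have : has (adj v) c by rewrite has_count pend.
  case/hasP => x xc vx; apply/mapP; exists x => //; apply/esym/andP; split=> //.
  by apply/existsP; exists v; rewrite vNc adj_sym.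
have := nth_index false (_ : true \in b); rewrite -index_mem -/k => /(_ kb) bk.
rewrite /gap_lengths -/b -/k /b -map_rot.
have sizec2 : size (rot k c) = size c by rewrite size_rot.
have cycle_c2 : is_cycle_seq adj (rot k c) by rewrite /is_cycle_seq rot_uniq size_rot rot_cycle.
have memc2 : rot k c =i c by move=> z; rewrite mem_rot.
have : nth false (map (is_major adj c) (rot k c)) 0.
  by rewrite map_rot -/b /rot nth_cat size_drop subn_gt0 kb nth_drop addn0 bk.
case E : (rot k c) => [|x p] //= /andP[xc /existsP[u /andP[uNc xu]]].
set t := [seq z <- enum V | z \notin c].
have ut : u \in t by rewrite mem_filter uNc mem_enum.
have tNc z : (z \in t) = (z \notin c) by rewrite mem_filter mem_enum andbT.
have ut2 : uniq t by rewrite filter_uniq ?enum_uniq.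
have W0 y z : y \notin c -> z \notin c -> signed_weight y z = 0.
  by move=> yc zc; apply/signed_weight_nadj/indep.
have pc y : y \in p -> y \in c by rewrite -memc2 E inE => ->; rewrite orbT.
have Wleaf w : w \notin c ->
    {in c &, forall y z, signed_weight w y != 0 -> signed_weight w z != 0 -> y = z}.
  by move=> wc y z yc zc; rewrite !signed_weight_neq0; apply: (count1_inj (pend w wc)).
have xNp : x \notin p by move: uc; rewrite -(rot_uniq k) E => /andP[].
have upt : uniq (p ++ rem u t).
  rewrite cat_uniq rem_uniq // andbT; apply/andP; split.
    by move: uc; rewrite -(rot_uniq k) E => /andP[].
  by apply/hasPn => w /mem_rem; rewrite tNc; apply: contra => /pc.
have symW := signed_weight_sym.
rewrite i_minus_neg_index (@neg_index_perm _ _ _ _ ([:: u, x & p ++ rem u t])) //; last first.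
  apply: uniq_perm; first exact: enum_uniq.
    have ux : u != x by apply: contraNneq uNc => ->.
    have up : u \notin p by apply: contra uNc => /pc.
    have xt : x \notin rem u t by apply/negP => /mem_rem; rewrite tNc xc.
    by rewrite /= upt andbT !inE !mem_cat !negb_or ux up xNp xt (mem_rem_uniq u ut2) inE eqxx.
  move=> z; rewrite mem_enum !inE mem_cat (mem_rem_uniq u ut2) inE tNc -(memc2 z) E inE.
  by case: eqP => //=; case: eqP => //=; case: (z \in p).
rewrite neg_index_leaf //; first last.
- by rewrite signed_weight_neq0 adj_sym.
- exact: signed_weight_diag.
- move=> y; rewrite inE mem_cat => /or3P[/eqP->|yp|/mem_rem]; last by rewrite tNc; apply: W0.
    exact: W0.
  apply/eqP; apply: contraNT xNp => uy.
  by rewrite (Wleaf u uNc x y) // ?pc // signed_weight_neq0 adj_sym.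
rewrite (@neg_index_path _ _ _ x0) //; first last.
- move=> w /mem_rem; rewrite tNc => wc y z yp zp; apply: Wleaf => //; exact: pc.
- by move=> y z /mem_rem + /mem_rem; rewrite !tNc; apply: W0.
- move=> i j /andP[ij jp]; rewrite signed_weight_neq0.
  (* Positions in [p] are one higher in [x :: p], so no pair within [p] is the closing edge. *)
  have := @cycle_chordless _ _ x0 adj_sym _ cycle_c2 _ i.+1 j.+1; rewrite E /= orbF => -> //.
    by move=> c' /same_size ->; rewrite -sizec2 E.
  by rewrite !ltnS ij.
- exact: signed_weight_diag.
have -> : [seq has (fun w => signed_weight y w != 0) (rem u t) | y <- p] =
    map (is_major adj c) p.
  apply/eq_in_map => y yp; rewrite /is_major pc //=.
  apply/hasP/existsP => [[w /mem_rem]|[w /andP[wNc yw]]].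
    by rewrite tNc signed_weight_neq0 => wNc yw; exists w; rewrite wNc.
  exists w; last by rewrite signed_weight_neq0.
  rewrite (mem_rem_uniq u ut2) inE tNc wNc andbT; apply: contraNneq xNp => wu.
  by rewrite (Wleaf u uNc x y) // ?pc // signed_weight_neq0 adj_sym // -wu.
(* The removed pair adds 2 after doubling: one unit is the successor in [path_index_runs], the other
   accounts for [x] in [size c]. *)
have := path_index_runs (map (is_major adj c) p); rewrite size_map -sizec2 E /=.
by rewrite doubleS addSn => ->.
Qed.

End SignedGraph.

Theorem theorem3p2 (R : rcfType) (V : finType) (adj : rel V)
  (sg : V -> V -> bool) (c : seq V) :
  simple_graph adj -> sign_on_edges adj sg ->
  unicyclic_with_cycle adj c -> canonical_wrt adj c ->
  let g := size c in
  let ceil_half := (g.+1)./2 in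
  [/\ (forall v, v \in c) ->
        (i_minus R adj sg = ceil_half <->
         (balanced sg c /\ (g %% 4 = 2 \/ g %% 4 = 3)) \/
         (~~ balanced sg c /\ (g %% 4 = 0 \/ g %% 4 = 1))),
      (exists v, v \notin c) -> (g %% 4 = 1 \/ g %% 4 = 3) ->
        (i_minus R adj sg = ceil_half <->
         count (fun l => ~~ odd l) (gap_lengths adj c) = 1) &
      (exists v, v \notin c) -> (g %% 4 = 0 \/ g %% 4 = 2) ->
        (i_minus R adj sg = ceil_half <-> all odd (gap_lengths adj c))]%N.
Proof.
move=> adjG sgG [_ cycle_c unique] canon g ceil_half.
have same_size c' : is_cycle_seq adj c' -> size c' = size c.
  by move=> /unique[i [] ->]; rewrite size_rot ?size_rev.
split.
- move=> Vc; have iE := i_minus_cycle R adjG sgG cycle_c same_size Vc.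
  rewrite /ceil_half /g iE.
  by case: (balanced sg c); split; lia.
(* Twice the ceiling is g + 1 for odd g, which leaves exactly one even gap; for even g it is g,
   which leaves none. *)
- move=> /(i_minus_noncycle R adjG sgG cycle_c same_size canon) iE g_odd.
  by rewrite /ceil_half /g in g_odd *; split; lia.
- move=> /(i_minus_noncycle R adjG sgG cycle_c same_size canon) iE g_even.
  have -> : all odd (gap_lengths adj c) = (count (fun l => ~~ odd l) (gap_lengths adj c) == 0).
    by rewrite eqn0Ngt -has_count has_predC negbK.
  by rewrite /ceil_half /g in g_even *; split; lia.
Qed.
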